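(* Let $G=(V,E)$ be a finite connected simple graph, let $\mathbf{U}$ be a universal adjacency matrix of $G$, and let $\lambda\in\mathrm{spec}(\mathbf{U})$. Suppose the $\lambda$-core distance partition $\mathcal{V}_\lambda$ is an equitable partition (with respect to $\mathbf{U}$) with divisor matrix $\mathbf{B}$ and characteristic matrix $\mathbf{C}$. Let $\mu\in\mathrm{spec}(\mathbf{B})$. Then there exists a subset of $CV_\mu$ (the set of $\mu$-core vertices for $\mathbf{U}$) which is the disjoint union of a finite collection of blocks of $\mathcal{V}_\lambda$. Moreover, if $m_{\mathbf{U}}(\mu)=m_{\mathbf{B}}(\mu)$, then equality holds between the two sets, i.e. $CV_\mu$ itself is the disjoint union of a finite collection of blocks of $\mathcal{V}_\lambda$, and $\mathcal{V}_\mu$ can be constructed from $\mathcal{V}_\lambda$, i.e. every block of $\mathcal{V}_\mu$ is a disjoint union of blocks of $\mathcal{V}_\lambda$.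
   Context: Graphs are finite, undirected, connected, without loops or multiple edges, with vertex set $V=\{v_1,\dots,v_n\}$. Let $\mathbf{A}$ be the adjacency matrix, $\mathbf{D}$ the diagonal matrix of vertex degrees, $\mathbf{I}$ the identity and $\mathbf{J}$ the all-ones matrix, all $n\times n$. A universal adjacency matrix of $G$ is a matrix $\mathbf{U}=\gamma_A\mathbf{A}+\gamma_D\mathbf{D}+\gamma_I\mathbf{I}+\gamma_J\mathbf{J}$ with real scalars $\gamma_A\neq 0,\gamma_D,\gamma_I,\gamma_J$. For a matrix $\mathbf{M}$, $\mathrm{spec}(\mathbf{M})$ is its spectrum and $m_{\mathbf{M}}(\lambda)$ is the multiplicity of the eigenvalue $\lambda$ in it. For an eigenvalue $\lambda$ of $\mathbf{U}$, a vertex $v_i$ is a $\lambda$-core vertex if there is an eigenvector $\mathbf{x}$ with $\mathbf{U}\mathbf{x}=\lambda\mathbf{x}$ whose $i$-th entry is non-zero. $CV_\lambda$ denotes the set of $\lambda$-core vertices. With $d(u,v)$ the length of a shortest path between $u$ and $v$, define $d_\lambda(v)=\min\{d(v,u): u\in CV_\lambda\}$, $D_\lambda=\max\{d_\lambda(v): v\in V\}$, and $V_{\lambda,i}=\{v\in V: d_\lambda(v)=i\}$ for $0\le i\le D_\lambda$; in particular $V_{\lambda,0}=CV_\lambda$. The $\lambda$-core distance partition is the partition $\mathcal{V}_\lambda=\{V_{\lambda,0},\dots,V_{\lambda,D_\lambda}\}$ of $V$. The characteristic matrix of a partition $\{V_1,\dots,V_k\}$ of $V$ is the $n\times k$ matrix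 $\mathbf{C}$ whose $i$-th column is the $0/1$ indicator vector of $V_i$ (for $\mathcal{V}_\lambda$, column $i$ corresponds to $V_{\lambda,i-1}$). The partition is equitable if there is a $k\times k$ matrix $\mathbf{B}$, the divisor matrix, with $\mathbf{U}\mathbf{C}=\mathbf{C}\mathbf{B}$. In that case the characteristic polynomial of $\mathbf{B}$ divides that of $\mathbf{U}$, so every eigenvalue $\mu$ of $\mathbf{B}$ is an eigenvalue of $\mathbf{U}$ and $CV_\mu$, $\mathcal{V}_\mu$ are defined. *)

(* Defs.v *)
From mathcomp Require Import all_boot all_order all_algebra.
From mathcomp Require Import boolp reals.

Set Implicit Arguments.
Unset Strict Implicit.
Unset Printing Implicit Defensive.

Import GRing.Theory.
Local Open Scope ring_scope.

Record cgraph (n : nat) := CGraph {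
  adj :> rel 'I_n;
  adj_sym : symmetric adj;
  adj_irr : irreflexive adj;
  adj_conn : forall u v : 'I_n, connect adj u v
}.

Definition has_walk (n : nat) (G : cgraph n) (u v : 'I_n) (k : nat) : bool :=
  [exists p : k.-tuple 'I_n, path G u p && (last u p == v)].

Lemma has_walk_ex (n : nat) (G : cgraph n) (u v : 'I_n) :
  exists k, has_walk G u v k.
Proof.
have /connectP [p Gp ->] := adj_conn G u v.
by exists (size p); apply/existsP; exists (in_tuple p); rewrite Gp eqxx.
Qed.

(* A walk of minimal length is a path, so this is the usual graph distance. *)
Definition dist (n : nat) (G : cgraph n) (u v : 'I_n) : nat :=
  ex_minn (has_walk_ex G u v).

Definition adj_mx (R : realType) (n : nat) (G : cgraph n) : 'M[R]_n :=
  \matrix_(i, j) (G i j)%:R.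

Definition deg_mx (R : realType) (n : nat) (G : cgraph n) : 'M[R]_n :=
  diag_mx (\row_i #|[set j | G i j]|%:R).

Definition universal_adj_mx (R : realType) (n : nat) (G : cgraph n)
    (U : 'M[R]_n) : Prop :=
  exists gA gD gI gJ : R, gA != 0 /\
    U = gA *: adj_mx R G + gD *: deg_mx R G + gI *: 1%:M + gJ *: const_mx 1.

Definition mult (R : realType) (n : nat) (M : 'M[R]_n) (a : R) : nat :=
  mup a (char_poly M).

Section CoreDistance.

Variables (R : realType) (n : nat) (G : cgraph n) (U : 'M[R]_n) (a : R).

Definition core_vertices : {set 'I_n} :=
  [set i | `[< exists x : 'cV[R]_n, U *m x = a *: x /\ x i 0 != 0 >] ].

(* All distances in G are smaller than n, so the neutral element n does not
   affect the minimum as soon as there is a core vertex, i.e. as soon as a is an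
   eigenvalue of U. *)
Definition core_dist (v : 'I_n) : nat :=
  \big[minn/n]_(u in core_vertices) dist G v u.

Definition core_diam : nat := \max_(v < n) core_dist v.

Definition core_block (i : nat) : {set 'I_n} := [set v | core_dist v == i].

Definition core_partition : {set {set 'I_n}} :=
  [set core_block i | i : 'I_core_diam.+1].

Definition core_char_mx : 'M[R]_(n, core_diam.+1) :=
  \matrix_(v, i) (v \in core_block i)%:R.

Definition core_divisor_mx (B : 'M[R]_core_diam.+1) : Prop :=
  U *m core_char_mx = core_char_mx *m B.

End CoreDistance.

Arguments core_divisor_mx {R n} G U a B.

Definition disjoint_union_of_blocks (T : finType) (P : {set {set T}})
    (S : {set T}) : Prop :=
  exists Q : {set {set T}}, [/\ Q \subset P, trivIset Q & S = cover Q].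

(* Main.v *)
Require Import Defs.
From mathcomp Require Import all_boot all_order all_algebra.
From mathcomp Require Import boolp reals.

Set Implicit Arguments.
Unset Strict Implicit.
Unset Printing Implicit Defensive.

Import Order.TTheory GRing.Theory Num.Theory.
Local Open Scope ring_scope.

(* If [B y = mu y] then [C y] is a [mu]-eigenvector of [U] that is constant on
   the blocks, so the set [S] of vertices where some such [C y] is non-zero is a
   union of blocks inside [CV_mu]. As [U] is symmetric, it also preserves the
   orthogonal complement of the column space of [C]; the characteristic
   polynomial of [U] is that of [B] times that of the restriction to this
   complement. When the multiplicities agree, [mu] is not an eigenvalue of the
   restriction, every [mu]-eigenvector of [U] is some [C y], and [S = CV_mu].
   Finally, equitability makes the presence of a neighbour in another block
   depend only on the block of a vertex, so walks can be transported between
   vertices of one block and the distance to [CV_mu] is constant on blocks. *)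

(** * Linear algebra: invariant complements and characteristic polynomials *)

Lemma char_poly_tr (R : comNzRingType) (n : nat) (A : 'M[R]_n) :
  char_poly A^T = char_poly A.
Proof.
rewrite /char_poly -[RHS]det_tr; congr (\det _).
by apply/matrixP => i j; rewrite !mxE eq_sym.
Qed.

(** In the basis formed by the rows of [E] and [K], [U] becomes block diagonal. The similarity is
    kept as an intertwining relation over polynomials, from which the non-zero determinant of the
    basis cancels. *)
Lemma char_poly_invariant_sum (F : fieldType) (m p : nat) (U : 'M[F]_(m + p))
    (E : 'M_(m, m + p)) (K : 'M_(p, m + p)) (A : 'M_m) (B : 'M_p) :
  col_mx E K \in unitmx -> E *m U = A *m E -> K *m U = B *m K ->
  char_poly U = char_poly A * char_poly B.
Proof.
set P := col_mx E K => Pu EU KU.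
have PU : P *m U = block_mx A 0 0 B *m P.
  by rewrite mul_col_mx EU KU mul_block_col !mul0mx addr0 add0r.
have PX : map_mx polyC P *m char_poly_mx U
    = block_mx (char_poly_mx A) 0 0 (char_poly_mx B) *m map_mx polyC P.
  have -> : block_mx (char_poly_mx A) 0 0 (char_poly_mx B)
      = 'X%:M - map_mx polyC (block_mx A 0 0 B).
    rewrite map_block_mx !map_mx0 scalar_mx_block opp_block_mx add_block_mx.
    by rewrite !subr0.
  by rewrite mulmxBr mulmxBl -!map_mxM PU scalar_mxC.
have := congr1 (fun M => \det M) PX; rewrite !det_mulmx det_ublock mulrC.
apply: mulIf; rewrite det_map_mx polyC_eq0 -unitfE.
by move: Pu; rewrite unitmxE.
Qed.

Lemma mul_tr_eq0 (R : realFieldType) (n : nat) (v : 'rV[R]_n) :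
  v *m v^T = 0 -> v = 0.
Proof.
move=> /matrixP /(_ 0 0); rewrite !mxE => /eqP.
rewrite psumr_eq0 => [/allP v0|i _]; last by rewrite mxE -expr2 sqr_ge0.
apply/rowP => i; have := v0 i (mem_index_enum i).
by rewrite !mxE mulf_eq0 orbb => /eqP.
Qed.

(* The orthogonal complement of the column space of [C] is [U]-invariant;
   the hypothesis on multiplicities leaves no eigenvector in it. *)
Lemma eigenvector_in_invariant (R : realFieldType) (n k : nat) (U : 'M[R]_n)
    (C : 'M_(n, k)) (B : 'M_k) (mu : R) :
  U^T = U -> U *m C = C *m B -> row_free C^T ->
  mup mu (char_poly U) = mup mu (char_poly B) ->
  forall x : 'cV_n, U *m x = mu *: x -> exists y : 'cV_k, x = C *m y.
Proof.
move=> Us UC Cfree.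
have CU : C^T *m U = B^T *m C^T by rewrite -{1}Us -!trmx_mul UC.
(* A vector of both spaces is orthogonal to itself, hence zero over an ordered field. *)
have capE : (C^T :&: kermx C)%MS = 0.
  apply/eqP/rowV0P => v; rewrite sub_capmx => /andP[/submxP[w ->] /sub_kermxP].
  move=> wCC; apply: mul_tr_eq0.
  by rewrite trmx_mul trmxK mulmxA wCC mul0mx.
set K := row_base (kermx C).
have KC : K *m C = 0 by apply/sub_kermxP; rewrite eq_row_base.
have /submxP[B' KU] : (K *m U <= K)%MS.
  by rewrite eq_row_base; apply/sub_kermxP; rewrite -mulmxA UC mulmxA KC mul0mx.
have Kfree : row_free K by apply: row_base_free.
have capK : (C^T :&: K)%MS = 0.
  by apply/eqP; rewrite -submx0 -capE capmxS // eq_row_base.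
(* The rank is abstracted to [p] so that [n] can be replaced by [k + p], the size required of a
   block matrix. *)
move: K KC B' KU Kfree capK; set p := \rank (kermx C) => K KC B' KU Kfree capK.
have Pfree : row_free (col_mx C^T K).
  rewrite /row_free -addsmxE mxrank_disjoint_sum //.
  by rewrite (eqP Cfree) (eqP Kfree).
have np : n = (k + p)%N.
  have /eqP rC := Cfree; rewrite mxrank_tr in rC.
  by rewrite /p mxrank_ker rC subnKC // -rC rank_leq_row.
clearbody p; clear capE; subst n => mumu x Ux.
have Pu : col_mx C^T K \in unitmx by rewrite -row_free_unit.
have := char_poly_invariant_sum Pu CU KU.
rewrite char_poly_tr => chU; move: mumu; rewrite chU.
rewrite mupM ?monic_neq0 ?char_poly_monic //.
rewrite -[RHS]addn0 => /addnI mu0.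
have mu_nB' : ~~ eigenvalue B' mu.
  rewrite eigenvalue_root_char -dvdp_XsubCl XsubC_dvd ?mu0 //.
  by rewrite monic_neq0 ?char_poly_monic.
have xU : x^T *m U = mu *: x^T by rewrite -{1}Us -trmx_mul Ux linearZ.
pose c := x^T *m invmx (col_mx C^T K).
have xc : x^T = c *m col_mx C^T K by rewrite mulmxKV.
have xab : x^T = lsubmx c *m C^T + rsubmx c *m K.
  by rewrite -mul_row_col hsubmxK.
(* Both sides of [x^T *m U = mu *: x^T] have unique coordinates in this basis; only the right halves
   are kept. *)
have bB : rsubmx c *m B' = mu *: rsubmx c.
  have /eq_row_mx[//] : row_mx (lsubmx c *m B^T) (rsubmx c *m B')
      = row_mx (mu *: lsubmx c) (mu *: rsubmx c).
  apply: (row_free_inj Pfree); rewrite !mul_row_col -!mulmxA -CU -KU !mulmxA.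
  by rewrite -mulmxDl -xab xU -!scalemxAl -scalerDr -xab.
have b0 : rsubmx c = 0.
  by apply: contraNeq mu_nB' => b0; apply/eigenvalueP; exists (rsubmx c).
exists (lsubmx c)^T; apply: trmx_inj.
by rewrite trmx_mul trmxK xab b0 mul0mx addr0.
Qed.

(** * Graph distance *)

Section Distance.
Variables (n : nat) (G : cgraph n).

Lemma dist_le (u v : 'I_n) (p : seq 'I_n) :
  path G u p -> last u p = v -> (dist G u v <= size p)%N.
Proof.
move=> Gp pv; rewrite /dist; case: ex_minnP => k _; apply.
by apply/existsP; exists (in_tuple p); rewrite Gp pv eqxx.
Qed.

Lemma dist_path (u v : 'I_n) :
  exists p, [/\ path G u p, last u p = v & size p = dist G u v].
Proof.
rewrite /dist; case: ex_minnP => k /existsP[p /andP[Gp /eqP pv]] _.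
by exists p; rewrite size_tuple.
Qed.

Lemma distxx (u : 'I_n) : dist G u u = 0%N.
Proof. by apply/eqP; rewrite -leqn0; apply: (@dist_le u u [::]). Qed.

Lemma dist_adj (u v w : 'I_n) : G u v -> (dist G u w <= (dist G v w).+1)%N.
Proof.
move=> Guv; have [p [Gp pw <-]] := dist_path v w.
by apply: (@dist_le u w (v :: p)); rewrite //= Guv.
Qed.

End Distance.

(** * Distance to the core, its blocks and their characteristic matrix *)

Section CoreDist.
Variables (R : realType) (n : nat) (G : cgraph n) (U : 'M[R]_n) (a : R).

Local Notation core := (core_vertices U a).
Local Notation cdist := (core_dist G U a).

(** The conjunct [k <= n] accounts for the neutral element [n] of the minimum. *)
Lemma core_dist_geP (v : 'I_n) (k : nat) :
  reflect (k <= n /\ forall u, u \in core -> k <= dist G v u)%N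
    (k <= cdist v)%N.
Proof.
rewrite /core_dist; apply: (iffP idP) => [k_le|[kn kd]].
  split=> [|u uC]; apply: leq_trans k_le _.
    by elim/big_rec: _ => // i j _ jn; rewrite geq_min jn orbT.
  by rewrite -minEnat -leEnat bigmin_le_cond.
by elim/big_ind: _ => // i j ki kj; rewrite leq_min ki.
Qed.

Lemma core_dist_core (v : 'I_n) : v \in core -> cdist v = 0%N.
Proof.
move=> vC; have /core_dist_geP[_ /(_ v vC)] := leqnn (cdist v).
by rewrite distxx leqn0 => /eqP.
Qed.

Lemma core_dist_adj (u v : 'I_n) : G u v -> (cdist u <= (cdist v).+1)%N.
Proof.
move=> Guv; have /core_dist_geP[un ud] := leqnn (cdist u).
rewrite -add1n -leq_subLR; apply/core_dist_geP; split=> [|w wC].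
  exact: leq_trans (leq_subr _ _) un.
by rewrite leq_subLR add1n (leq_trans (ud w wC)) // dist_adj.
Qed.

(** A discrete intermediate value argument: along an edge the core distance drops by at most one, so
    no level is skipped. *)
Lemma core_dist_path (i : nat) (u : 'I_n) (p : seq 'I_n) :
  path G u p -> (cdist (last u p) <= i <= cdist u)%N ->
  exists v, cdist v = i.
Proof.
elim: p u => [|w p IHp] u /=; first by move=> _ /anti_leq; exists u.
case/andP=> Guw Gp /andP[pi iu].
have [ui|] := eqVneq (cdist u) i; first by exists u.
rewrite neq_ltn ltnNge iu /= => ltiu; apply: (IHp w Gp); rewrite pi /=.
by rewrite -ltnS (leq_trans ltiu) // core_dist_adj.
Qed.

Lemma eigenvalue_core_neq0 : U^T = U -> eigenvalue U a -> core != set0.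
Proof.
move=> Us /eigenvalueP[v vU /rV0Pn[i vi]]; apply/set0Pn; exists i.
rewrite inE; apply/asboolP; exists v^T; rewrite mxE; split=> //.
by rewrite -{1}Us -trmx_mul vU linearZ.
Qed.

Lemma core_block_inhabited (i : nat) :
  core != set0 -> (i <= core_diam G U a)%N -> exists v, cdist v = i.
Proof.
case/set0Pn=> u uC; have n_gt0 : (0 < #|'I_n|)%N by apply/card_gt0P; exists u.
rewrite /core_diam; have [v ->] := bigop.eq_bigmax cdist n_gt0 => iv.
have /connectP[p Gp pu] := adj_conn G v u.
by apply: (core_dist_path Gp); rewrite -pu core_dist_core.
Qed.

Lemma core_dist_le_diam (v : 'I_n) : (cdist v < (core_diam G U a).+1)%N.
Proof. by rewrite ltnS (leq_bigmax v). Qed.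

Lemma core_block_union (S : {set 'I_n}) :
  (forall v w, cdist v = cdist w -> v \in S -> w \in S) ->
  disjoint_union_of_blocks (core_partition G U a) S.
Proof.
move=> Sclosed.
exists [set W in core_partition G U a | W \subset S]; split.
- by apply/subsetP => W; rewrite inE => /andP[].
- apply/trivIsetP => W W'; rewrite !inE.
  move=> /andP[/imsetP[i _ ->] _] /andP[/imsetP[j _ ->] _] neq_ij.
  apply/pred0P => v /=; rewrite !inE; apply: contraNF neq_ij.
  by move=> /andP[/eqP <- /eqP <-].
- apply/setP => v; apply/idP/bigcupP => [vS|[W]]; last first.
    by rewrite inE => /andP[_ /subsetP WS] /WS.
  exists (core_block G U a (cdist v)); last by rewrite inE.
  rewrite inE; apply/andP; split.
    by apply/imsetP; exists (Ordinal (core_dist_le_diam v)).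
  by apply/subsetP => w; rewrite inE => /eqP wv; apply: Sclosed vS.
Qed.

Local Notation C := (core_char_mx G U a).

(** Each vertex lies in exactly one block, so row [v] of [C] is a unit vector. *)
Lemma core_char_mxE (m : nat) (Y : 'M_(_, m)) (v : 'I_n) (j : 'I_m) :
  (C *m Y) v j = Y (Ordinal (core_dist_le_diam v)) j.
Proof.
rewrite mxE (bigD1 (Ordinal (core_dist_le_diam v))) //= mxE inE eqxx mul1r.
rewrite big1 ?addr0 // => i; rewrite mxE inE -val_eqE /= eq_sym.
by move=> /negPf->; rewrite mul0r.
Qed.

(** No block is empty, so every row of [Y] shows up as a row of [C *m Y]. *)
Lemma core_char_mx_inj (m : nat) : core != set0 ->
  injective (fun Y : 'M_(_, m) => C *m Y).
Proof.
move=> core_n0 Y Z /matrixP eqYZ; apply/matrixP => i j.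
have [v vi] := core_block_inhabited core_n0 (ltn_ord i).
have <- : Ordinal (core_dist_le_diam v) = i by apply: val_inj.
by rewrite -!core_char_mxE eqYZ.
Qed.

Lemma core_char_mx_free : core != set0 -> row_free C^T.
Proof.
move=> core_n0; rewrite -kermx_eq0; apply/eqP/trmx_inj.
apply: (core_char_mx_inj core_n0).
by apply: trmx_inj; rewrite /= trmx_mul trmxK mulmx_ker !trmx0 mulmx0 trmx0.
Qed.

End CoreDist.

(** * Equitability and transport of walks *)

Lemma universal_adj_mx_sym (R : realType) (n : nat) (G : cgraph n) (U : 'M[R]_n) :
  universal_adj_mx G U -> U^T = U.
Proof.
case=> gA [gD [gI [gJ [_ ->]]]]; apply/matrixP => i j; rewrite !mxE.
by rewrite adj_sym [j == i]eq_sym; case: eqVneq => [->|].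
Qed.

(* Off the block [V_j] the matrix [U] is [gA A + gJ J], so the sum of [U] over
   [V_j] tells whether a vertex has a neighbour there. *)
Lemma equitable_neighbour (R : realType) (n : nat) (G : cgraph n) (U : 'M[R]_n)
    (a : R) (B : 'M[R]_((core_diam G U a).+1)) (v v' w : 'I_n) :
  universal_adj_mx G U -> core_divisor_mx G U a B ->
  core_dist G U a v' = core_dist G U a v ->
  core_dist G U a w != core_dist G U a v -> G v w ->
  exists2 w', G v' w' & core_dist G U a w' = core_dist G U a w.
Proof.
move=> [gA [gD [gI [gJ [gA0 defU]]]]] UC vv' wv Gvw.
have Uoff u t : u != t -> U u t = gA * (G u t)%:R + gJ.
  by move=> /negPf ut; rewrite defU !mxE ut !mulr0n !mulr0 !addr0 mulr1.
pose j := Ordinal (core_dist_le_diam G U a w).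
(* The number of neighbours of [u] in the block of [w]. *)
pose N u : R := \sum_t (G u t && (core_dist G U a t == j))%:R.
have sumU u : core_dist G U a u != core_dist G U a w ->
    (U *m core_char_mx G U a) u j
      = gA * N u + gJ * \sum_t (core_dist G U a t == j)%:R.
  move=> uw; rewrite mxE !big_distrr -big_split /=; apply: eq_bigr => t _.
  rewrite [core_char_mx _ _ _ t j]mxE inE.
  have [tj|] := eqVneq; last by rewrite andbF !mulr0 addr0.
  by rewrite andbT !mulr1 Uoff //; apply: contraNneq uw => ->; rewrite tj.
have NE : N v' = N v.
  have := sumU v; rewrite eq_sym => /(_ wv).
  have := sumU v'; rewrite vv' eq_sym => /(_ wv).
  rewrite UC !core_char_mxE.
  have -> : Ordinal (core_dist_le_diam G U a v')
      = Ordinal (core_dist_le_diam G U a v) by apply: val_inj.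
  by move=> -> /addIr /(mulfI gA0).
have Nv : N v != 0.
  rewrite psumr_neq0; last by move=> *; rewrite ler0n.
  by apply/hasP; exists w; rewrite ?mem_index_enum //= Gvw eqxx ltr01.
move: Nv; rewrite -NE psumr_neq0; last by move=> *; rewrite ler0n.
case/hasP=> w' _ /=; rewrite ltr0n lt0b => /andP[Gw' /eqP w'j].
by exists w'.
Qed.

(** The walk is copied edge by edge: an edge between two labels is lifted, an edge within one label
    is dropped, so the length cannot grow. *)
Lemma label_path (n : nat) (G : cgraph n) (T : eqType) (f : 'I_n -> T) :
  (forall v v' w, f v' = f v -> f w != f v -> G v w ->
     exists2 w', G v' w' & f w' = f w) ->
  forall p v v', f v' = f v -> path G v p ->
  exists q, [/\ path G v' q, f (last v' q) = f (last v p)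
    & (size q <= size p)%N].
Proof.
move=> fG; elim=> [|w p IHp] v v' vv' /=; first by exists [::].
case/andP=> Gvw Gp; have [wv|wv] := eqVneq (f w) (f v).
  have [|q [Gq qp sq]] := IHp w v' _ Gp; first by rewrite vv'.
  by exists q; split=> //; apply: leqW.
have [w' Gw' w'w] := fG v v' w vv' wv Gvw.
by have [q [Gq qp sq]] := IHp w w' w'w Gp; exists (w' :: q); rewrite /= Gw'.
Qed.

Lemma label_core_dist (R : realType) (n : nat) (G : cgraph n) (U : 'M[R]_n)
    (a : R) (T : eqType) (f : 'I_n -> T) :
  (forall v v' w, f v' = f v -> f w != f v -> G v w ->
     exists2 w', G v' w' & f w' = f w) ->
  (forall v w, f v = f w -> v \in core_vertices U a ->
     w \in core_vertices U a) ->
  forall v w, f v = f w -> core_dist G U a v = core_dist G U a w.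
Proof.
move=> fG fcore v w vw; apply/eqP; rewrite eqn_leq.
suff le_dist v1 w1 : f v1 = f w1 -> (core_dist G U a v1 <= core_dist G U a w1)%N.
  by rewrite !le_dist.
(* A shortest walk from [w1] to a core vertex is copied from [v1]; its end keeps its label, hence
   stays in the core. *)
move=> vw1; apply/core_dist_geP.
have /core_dist_geP[vn vd] := leqnn (core_dist G U a v1).
split=> // u uC; have [p [Gp pu <-]] := dist_path G w1 u.
have [q [Gq qp sq]] := label_path fG vw1 Gp.
apply: leq_trans sq; apply: leq_trans (dist_le Gq erefl); apply: vd.
by apply: fcore uC; rewrite -pu.
Qed.

Theorem theorem2p11 (R : realType) (n : nat) (G : cgraph n) (U : 'M[R]_n)
    (hU : universal_adj_mx G U) (lambda : R) (hlambda : eigenvalue U lambda)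
    (B : 'M[R]_((core_diam G U lambda).+1)) (hB : core_divisor_mx G U lambda B)
    (mu : R) (hmu : eigenvalue B mu) :
  exists S : {set 'I_n},
    [/\ S != set0, S \subset core_vertices U mu
      & disjoint_union_of_blocks (core_partition G U lambda) S]
    /\ (mult U mu = mult B mu ->
        S = core_vertices U mu
        /\ forall W : {set 'I_n}, W \in core_partition G U mu ->
             disjoint_union_of_blocks (core_partition G U lambda) W).
Proof.
have Us := universal_adj_mx_sym hU.
have core_n0 := eigenvalue_core_neq0 Us hlambda.
set C := core_char_mx G U lambda.
have Cy v w (y : 'cV[R]_((core_diam G U lambda).+1)) :
    core_dist G U lambda v = core_dist G U lambda w ->
    (C *m y) v 0 = (C *m y) w 0.
  by move=> vw; rewrite !core_char_mxE; congr (y _ _); apply: val_inj.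
pose S := [set v | `[< exists y : 'cV_((core_diam G U lambda).+1),
  B *m y = mu *: y /\ (C *m y) v 0 != 0 >]].
have S_closed v w : core_dist G U lambda v = core_dist G U lambda w ->
    v \in S -> w \in S.
  move=> vw; rewrite !inE => /asboolP[y [By yv]]; apply/asboolP.
  by exists y; rewrite -(Cy v w).
have S_core : S \subset core_vertices U mu.
  apply/subsetP => v; rewrite !inE => /asboolP[y [By yv]]; apply/asboolP.
  by exists (C *m y); split=> //; rewrite mulmxA hB -mulmxA By scalemxAr.
exists S; split.
  split; [|exact: S_core|exact: core_block_union].
    (* [eigenvalue] provides row eigenvectors; passing to [B^T] yields a column eigenvector of
       [B]. *)
    move: hmu; rewrite eigenvalue_root_char -char_poly_tr.
    rewrite -eigenvalue_root_char => /eigenvalueP[y yB y0].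
    have yT0 : C *m y^T != 0.
      apply: contraNneq y0 => Cy0; apply/eqP/trmx_inj.
      by apply: (core_char_mx_inj core_n0); rewrite -/C Cy0 trmx0 mulmx0.
    have [v yv] := cV0Pn _ yT0; apply/set0Pn; exists v; rewrite inE.
    apply/asboolP; exists y^T; split=> //.
    by apply: trmx_inj; rewrite trmx_mul linearZ /= trmxK.
move=> mumu; have SE : S = core_vertices U mu.
  apply/eqP; rewrite eqEsubset S_core /=; apply/subsetP => v; rewrite !inE.
  move=> /asboolP[x [Ux xv]]; apply/asboolP.
  have Cfree := core_char_mx_free G core_n0.
  have [y xy] := eigenvector_in_invariant Us hB Cfree mumu Ux.
  (* Injectivity of [C] reduces [B *m y = mu *: y] to its image under [C], which is the eigenvector
     equation of [x]. *)
  exists y; rewrite -xy; split=> //; apply: (core_char_mx_inj core_n0).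
  by rewrite /= mulmxA -hB -mulmxA -/C -xy Ux -scalemxAr -xy.
split=> // W /imsetP[i _ ->]; apply: core_block_union => v w vw.
rewrite !inE => /eqP <-; apply/eqP/esym.
(* The label of a vertex is its distance to the [lambda]-core. *)
apply: (label_core_dist _ _ vw) => [|v1 w1]; last first.
  by rewrite -SE; apply: S_closed.
by move=> v1 v1' w1 vv1 wv1; apply: (equitable_neighbour hU hB).
Qed.
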